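(* Let $P$ be a finite poset with $|P|\ge2$ and connected Hasse diagram that has a minimum element $\hat0$ or a maximum element $\hat1$. Then $U_P$ is Gorenstein if and only if $U_P$ is $\mathbb{Q}$-Gorenstein.
   Context: Identify $P$ with $[n]$; $N=\mathbb{Z}^n/\mathbb{Z}(1,\dots,1)$, $N_{\mathbb{R}}=N\otimes\mathbb{R}$, $M$ the dual lattice. The braid cone is $\sigma_P=\{x\in N_{\mathbb{R}}: x_i\le x_j\text{ whenever } i<_P j\}$ and $U_P$ is its affine toric variety. $U_P$ is $\mathbb{Q}$-Gorenstein if there exist $u\in M$ and a positive integer $r$ with $\langle u,v\rangle=r$ for every ray generator $v$ of $\sigma_P$; it is Gorenstein if this holds with $r=1$. *)

(* Defs.v *)
From HB Require Import structures.
From mathcomp Require Import all_boot all_order all_algebra.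
From mathcomp Require Import classical_sets reals.

Set Implicit Arguments.
Unset Strict Implicit.
Unset Printing Implicit Defensive.

Import Order.TTheory GRing.Theory Num.Theory.
Import Quotient.

Local Open Scope ring_scope.
Local Open Scope quotient_scope.
Local Open Scope classical_set_scope.

Section QuotientByDiagonal.
Variables (A : nzRingType) (I : finType).

(* For nonempty I, this is the submodule A(1,...,1) of A^I. *)
Definition diagonal : {pred {ffun I -> A}} :=
  fun x => [forall i, forall j, x i == x j].

Lemma diagonalP (x : {ffun I -> A}) :
  reflect (forall i j, x i = x j) (x \in diagonal).
Proof.
apply: (iffP forallP) => [h i j|h i]; first by have /forallP/(_ j)/eqP := h i.
by apply/forallP => j; rewrite (h i j).
Qed.

Lemma diagonal_zmod_closed : zmod_closed diagonal.
Proof.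
split=> [|x y /diagonalP hx /diagonalP hy]; apply/diagonalP => i j.
  by rewrite !ffunE.
by rewrite !ffunE (hx i j) (hy i j).
Qed.

HB.instance Definition _ :=
  GRing.isZmodClosed.Build {ffun I -> A} diagonal diagonal_zmod_closed.

Definition diag_quot : Type :=
  Quotient.quot (diagonal : zmodClosed {ffun I -> A}).

HB.instance Definition _ := GRing.Zmodule.on diag_quot.
HB.instance Definition _ := EqQuotient.on diag_quot.
HB.instance Definition _ := ZmodQuotient.on diag_quot.

Definition diag_pi (x : {ffun I -> A}) : diag_quot := \pi_diag_quot x.

Lemma diag_piP (x y : {ffun I -> A}) :
  diag_pi x = diag_pi y <-> (forall i j, x i - x j = y i - y j).
Proof.
have e (i j : I) :
    (x - y) i - (x - y) j = (x i - x j) - (y i - y j).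
  by rewrite !ffunE opprD addrACA -opprD.
rewrite /diag_pi; split=> [/eqP|h].
  rewrite piE equivE => /diagonalP h i j.
  by apply/eqP; rewrite -subr_eq0 -e (h i j) subrr.
apply/eqP; rewrite piE equivE; apply/diagonalP => i j.
by apply/eqP; rewrite -subr_eq0 e h subrr.
Qed.

Lemma diag_repr (x : diag_quot) : diag_pi (repr x) = x.
Proof. exact: reprK. Qed.

Lemma diag_piK (x : {ffun I -> A}) (i j : I) :
  repr (diag_pi x) i - repr (diag_pi x) j = x i - x j.
Proof. by move: i j; apply/diag_piP; rewrite diag_repr. Qed.

Lemma diag_pi_zmod_morphism : zmod_morphism diag_pi.
Proof. by move=> x y; rewrite /diag_pi !piE. Qed.

HB.instance Definition _ :=
  GRing.isZmodMorphism.Build {ffun I -> A} diag_quot diag_pi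
    diag_pi_zmod_morphism.

Definition diag_scale (a : A) (x : diag_quot) : diag_quot :=
  diag_pi [ffun i => a * repr x i].

Fact diag_scale_pi (a : A) (x : {ffun I -> A}) :
  diag_scale a (diag_pi x) = diag_pi [ffun i => a * x i].
Proof. by apply/diag_piP => i j; rewrite !ffunE -!mulrBr diag_piK. Qed.

Fact diag_scaleA (a b : A) (x : diag_quot) :
  diag_scale a (diag_scale b x) = diag_scale (a * b) x.
Proof.
rewrite -[x]diag_repr !diag_scale_pi; congr diag_pi.
by apply/ffunP => i; rewrite !ffunE mulrA.
Qed.

Fact diag_scale1 : left_id 1 diag_scale.
Proof.
move=> x; rewrite -[x]diag_repr diag_scale_pi; congr diag_pi.
by apply/ffunP => i; rewrite ffunE mul1r.
Qed.

Fact diag_scaleDr : right_distributive diag_scale +%R.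
Proof.
move=> a x y; rewrite -[x]diag_repr -[y]diag_repr -raddfD !diag_scale_pi.
rewrite -raddfD; congr diag_pi.
by apply/ffunP => i; rewrite !ffunE mulrDr.
Qed.

Fact diag_scaleDl (x : diag_quot) : {morph diag_scale^~ x : a b / a + b}.
Proof.
move=> a b; rewrite -[x]diag_repr !diag_scale_pi -raddfD; congr diag_pi.
by apply/ffunP => i; rewrite !ffunE mulrDl.
Qed.

HB.instance Definition _ :=
  GRing.Zmodule_isLmodule.Build A diag_quot
    diag_scaleA diag_scale1 diag_scaleDr diag_scaleDl.

Lemma diag_piZ (a : A) (x : {ffun I -> A}) :
  diag_pi [ffun i => a * x i] = a *: diag_pi x.
Proof. by rewrite -diag_scale_pi. Qed.

End QuotientByDiagonal.

Arguments diag_pi {A I} x.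

Section Cones.
Variables (R : realType) (V : lmodType R).
Implicit Types C F : set V.

Definition dual_cone C : set {linear V -> R^o} :=
  [set m : {linear V -> R^o} | forall x, C x -> 0 <= (m x : R)].

Definition is_face C F : Prop :=
  exists2 m : {linear V -> R^o}, dual_cone C m & F = C `&` [set x | m x = 0].

(* The linear span of F has dimension one. *)
Definition one_dimensional F : Prop :=
  exists v : V, [/\ v != 0, F v & forall x, F x -> exists c : R, x = c *: v].

Definition is_ray C F : Prop := is_face C F /\ one_dimensional F.

End Cones.

Section BraidCone.
Variables (R : realType) (d : Order.disp_t) (P : finPOrderType d).

Definition braid_lattice := diag_quot int P.
Definition braid_space := diag_quot R P.
Definition braid_dual_lattice := {linear diag_quot int P -> int^o}.

(* The map N -> N_R = N \otimes R. *)
Definition lattice_embed (v : braid_lattice) : braid_space :=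
  diag_pi [ffun i => (repr v i)%:~R].

Lemma lattice_embed_pi (x : {ffun P -> int}) :
  lattice_embed (diag_pi x) = diag_pi [ffun i => (x i)%:~R].
Proof. by apply/diag_piP => i j; rewrite !ffunE -!intrB diag_piK. Qed.

(* Only differences of coordinates are well defined on the quotient, so the
   choice of representative is immaterial: see braid_cone_pi. *)
Definition braid_cone : set braid_space :=
  [set x : braid_space | forall i j : P, (i < j)%O ->
     (repr x : {ffun P -> R}) i <= (repr x : {ffun P -> R}) j].

Lemma braid_cone_pi (x : {ffun P -> R}) :
  braid_cone (diag_pi x) <-> (forall i j : P, (i < j)%O -> x i <= x j).
Proof.
split=> h i j /h; first by rewrite -subr_ge0 diag_piK subr_ge0.
by move=> le_ij; rewrite -subr_ge0 diag_piK subr_ge0.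
Qed.

(* v generates the semigroup of lattice points of some ray of the cone. *)
Definition is_ray_generator (v : braid_lattice) : Prop :=
  exists2 F : set braid_space, is_ray braid_cone F &
    F (lattice_embed v) /\
    forall w : braid_lattice, F (lattice_embed w) -> exists k : nat, w = v *+ k.

Definition gorenstein_of_index (r : nat) : Prop :=
  exists u : braid_dual_lattice,
    forall v : braid_lattice, is_ray_generator v -> (u v : int) = r%:Z.

Definition q_gorenstein : Prop :=
  exists2 r : nat, (0 < r)%N & gorenstein_of_index r.

Definition gorenstein : Prop := gorenstein_of_index 1.

End BraidCone.

Section HasseDiagram.
Variables (d : Order.disp_t) (P : finPOrderType d).

Definition covers (x y : P) : bool :=
  (x < y)%O && ~~ [exists z : P, (x < z < y)%O].

Definition hasse_edge : rel P := fun x y => covers x y || covers y x.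

Definition hasse_connected : Prop := forall x y : P, connect hasse_edge x y.

Definition has_minimum : Prop := exists b : P, forall x : P, (b <= x)%O.

Definition has_maximum : Prop := exists t : P, forall x : P, (x <= t)%O.

End HasseDiagram.

(* Main.v *)
(* Let [1_F] be the class of the indicator function of an up-set [F].  If [P]
   has a minimum [b], then for [x != b] the principal filter of [x] and its
   complement are both connected, through [x] and [b]; hence [1_F] spans a ray
   of the braid cone when [F] is this filter.  So a functional [u] that is
   constantly [r] on the ray generators takes the value [r] on every principal
   filter, except on [P] itself, where it takes the value [0].  By Moebius
   inversion [r] divides [u] on every coordinate vector, so [u / r] is an
   integral functional.  If [P] has a maximum, one uses the complements of
   principal ideals instead. *)

From HB Require Import structures.
Require Import Defs.
From mathcomp Require Import all_boot all_order all_algebra.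
From mathcomp Require Import classical_sets reals.

Set Implicit Arguments.
Unset Strict Implicit.
Unset Printing Implicit Defensive.

Import Order.TTheory GRing.Theory Num.Theory.

Local Open Scope ring_scope.

Section Indicator.
Variables (A : nzRingType) (I : finType).

Definition indic (F : {pred I}) : diag_quot A I :=
  diag_pi [ffun i => (i \in F)%:R].

Lemma indicE (F : {pred I}) : indic F = \sum_(i in F) indic (pred1 i).
Proof.
rewrite -raddf_sum; congr diag_pi; apply/ffunP => j.
rewrite sum_ffunE ffunE; under eq_bigr do rewrite ffunE inE.
have [jF|jF] := boolP (j \in F).
  rewrite (bigD1 j) //= eqxx big1 ?addr0 // => i /andP[_ ne_ij].
  by rewrite eq_sym (negbTE ne_ij).
by rewrite big1 // => i iF; case: eqP jF => // ->; rewrite iF.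
Qed.

Lemma indicT : indic predT = 0.
Proof.
rewrite -[0](raddf0 diag_pi); apply/diag_piP => i j.
by rewrite !ffunE !subrr.
Qed.

Lemma indicC (F : {pred I}) : indic [predC F] = - indic F.
Proof.
apply/eqP; rewrite -addr_eq0 -raddfD -indicT; apply/eqP; congr diag_pi.
by apply/ffunP => i; rewrite !ffunE !inE; case: (i \in F); rewrite ?add0r ?addr0.
Qed.

Lemma diag_quot_sum (x : diag_quot A I) :
  x = \sum_i repr x i *: indic (pred1 i).
Proof.
rewrite -{1}[x]diag_repr; under eq_bigr do rewrite -diag_piZ.
rewrite -raddf_sum; congr diag_pi; apply/ffunP => j.
rewrite sum_ffunE (bigD1 j) //= !ffunE inE eqxx mulr1 big1 ?addr0 // => i ne_ij.
by rewrite !ffunE inE eq_sym (negbTE ne_ij) mulr0.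
Qed.

End Indicator.

(** The pointwise quotient by [r] is linear: multiplication by [r] is injective on [int], so
    linearity may be checked on [u] itself. *)
Lemma linear_divz (V : lmodType int) (u : {linear V -> int^o}) (r : int) :
    r != 0 -> (forall v, (r %| (u v : int))%Z) ->
  exists u' : {linear V -> int^o}, forall v, (u v : int) = (u' v : int) * r.
Proof.
move=> r0 ru; pose f (v : V) : int^o := ((u v : int) %/ r)%Z.
have fE v : (u v : int) = (f v : int) * r by rewrite divzK.
have f_lin : linear f.
  move=> a x y; apply: (mulIf r0); rewrite mulrDl -!fE linearP.
  by congr (_ + _); rewrite /= fE; apply: mulrA.
pose fM := GRing.isLinear.Build int V int^o *:%R f f_lin.
pose fL : {linear V -> int^o} := HB.pack f fM.
by exists fL.
Qed.

Lemma dvdz_principal_filters (d : Order.disp_t) (P : finPOrderType d)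
    (g : P -> int) (r : int) :
    (forall i, (r %| \sum_(j | (i <= j)%O) g j)%Z) ->
  forall i, (r %| g i)%Z.
Proof.
(* Moebius inversion as an induction on the number of elements strictly above [i]: the other terms
   of the filter sum at [i] have strictly fewer. *)
move=> h i; have [n] := ubnP #|[set j | (i < j)%O]|.
elim: n i => // n IHn i /ltnSE le_n.
have := h i; rewrite (bigD1 i) //= rpredDr //.
apply: rpred_sum => j /andP[le_ij ne_ji]; have lt_ij : (i < j)%O.
  by rewrite lt_neqAle eq_sym ne_ji.
apply/IHn/(leq_trans _ le_n)/proper_card/properP; split.
  by apply/fintype.subsetP => k; rewrite !inE; apply: lt_trans.
by exists j; rewrite !inE ?ltxx.
Qed.

Section Rays.
Variables (R : realType) (d : Order.disp_t) (P : finPOrderType d).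
Variable F : {pred P}.

Let same_side (p : P * P) := (p.1 < p.2)%O && ((p.1 \in F) == (p.2 \in F)).

(* The supporting functional that exposes the ray of [1_F]. *)
Definition side_variation (x : diag_quot R P) : R^o :=
  \sum_(p | same_side p) ((repr x : {ffun P -> R}) p.2 - repr x p.1).

Lemma side_variation_pi (x : {ffun P -> R}) :
  side_variation (diag_pi x) = \sum_(p | same_side p) (x p.2 - x p.1).
Proof. by apply: eq_bigr => p _; rewrite diag_piK. Qed.

Lemma side_variation_linear : linear side_variation.
Proof.
move=> a x y; rewrite -[x]diag_repr -[y]diag_repr -diag_piZ -raddfD.
rewrite !side_variation_pi scaler_sumr -big_split; apply: eq_bigr => p _ /=.
by rewrite !ffunE opprD addrACA -mulrBr.
Qed.

HB.instance Definition _ := GRing.isLinear.Build R (diag_quot R P) R^o *:%R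
  side_variation side_variation_linear.

(** [a] and [b] act as hubs that connect [F] and its complement; the relation [b < a] links the two
    sides and fixes the sign of the jump. *)
Variables a b : P.
Hypotheses (upF : forall i j, (i <= j)%O -> i \in F -> j \in F)
  (aF : a \in F) (bF : b \notin F) (lt_ba : (b < a)%O)
  (cmpa : forall i, i \in F -> (i >=< a)%O)
  (cmpb : forall i, i \notin F -> (i >=< b)%O).

Let face : set (braid_space R P) :=
  (@braid_cone R d P `&` [set x | side_variation x = 0])%classic.

Lemma braid_cone_indic : braid_cone (indic R F).
Proof.
apply/braid_cone_pi => i j /ltW le_ij; rewrite !ffunE ler_nat.
by case: (boolP (i \in F)) => // /(upF le_ij) ->.
Qed.

Lemma indic_face : face (indic R F).
Proof.
split; first exact: braid_cone_indic.
rewrite /= side_variation_pi big1 // => p /andP[_ /eqP e].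
by rewrite !ffunE e subrr.
Qed.

(** On the cone [side_variation] is a sum of nonnegative terms. If it vanishes, so does each term,
    and comparison with the hubs makes [x] constant on [F] and on its complement. *)
Lemma face_diff (x : {ffun P -> R}) : face (diag_pi x) ->
  0 <= x a - x b /\
  forall i j, x i - x j = (x a - x b) * ((i \in F)%:R - (j \in F)%:R).
Proof.
case=> /braid_cone_pi x_mono /=; rewrite side_variation_pi => /eqP.
rewrite psumr_eq0 => [/allP x0|p /andP[lt_p _]]; last first.
  by rewrite subr_ge0 x_mono.
have eq_lt i j : (i < j)%O -> (i \in F) = (j \in F) -> x i = x j.
  move=> lt_ij e; have := x0 (i, j) (mem_index_enum _).
  by rewrite /same_side /= lt_ij e eqxx subr_eq0 => /eqP.
have eq_cmp i j : (i >=< j)%O -> (i \in F) = (j \in F) -> x i = x j.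
  by case: comparableP => // [lt_ij|lt_ji|->] // _ e; [|symmetry]; apply: eq_lt.
have xE i : x i = x b + (x a - x b) * (i \in F)%:R.
  case: (boolP (i \in F)) => iF.
    by rewrite mulr1 addrC subrK; apply: eq_cmp; rewrite ?cmpa ?iF ?aF.
  rewrite mulr0 addr0.
  by apply: eq_cmp; rewrite ?cmpb // (negbTE iF) (negbTE bF).
split=> [|i j]; first by rewrite subr_ge0 x_mono.
by rewrite mulrBr {1}(xE i) {1}(xE j) opprD addrACA subrr add0r.
Qed.

Lemma indic_ray_generator : is_ray_generator R (indic int F).
Proof.
have embedF : lattice_embed R (indic int F) = indic R F.
  rewrite lattice_embed_pi; congr diag_pi.
  by apply/ffunP => i; rewrite !ffunE; case: (i \in F).
exists face; [split|split].
- exists side_variation => // x; rewrite -[x]diag_repr => /braid_cone_pi x_mono.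
  rewrite /= side_variation_pi; apply: sumr_ge0 => p /andP[lt_p _].
  by rewrite subr_ge0 x_mono.
- exists (indic R F); split; [|exact: indic_face|].
    (* The class is nonzero because its coordinates at [a] and [b] differ by 1. *)
    apply/eqP; rewrite -[0](raddf0 diag_pi) => /diag_piP /(_ a b).
    rewrite !ffunE aF (negbTE bF) !subr0 => /eqP.
    by rewrite oner_eq0.
  move=> x; rewrite -[x]diag_repr => /face_diff[_ xE].
  exists (repr x a - repr x b); rewrite -diag_piZ; apply/diag_piP => i j.
  by rewrite xE !ffunE mulrBr.
- by rewrite embedF; exact: indic_face.
move=> w; rewrite -[w]diag_repr lattice_embed_pi => /face_diff[].
set y : {ffun P -> int} := repr w; rewrite !ffunE -intrB ler0z => y_ge0 yE.
(* The multiplier is the jump from [b] to [a], an integer that is nonnegative on the face. *)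
exists `|y a - y b|%N; rewrite -scaler_nat -diag_piZ; apply/diag_piP => i j.
apply: (@intr_inj R); have := yE i j; rewrite !ffunE -intrB => ->.
rewrite natz gez0_abs // -mulrBr intrM; congr (_ * _).
by rewrite rmorphB /= !rmorph_nat.
Qed.

End Rays.

Lemma dvdz_linear (I : finType) (u : {linear diag_quot int I -> int^o})
    (r : int) :
    (forall i, (r %| (u (indic int (pred1 i)) : int))%Z) ->
  forall v, (r %| (u v : int))%Z.
Proof.
move=> h v; rewrite [v]diag_quot_sum raddf_sum.
by apply: rpred_sum => i _; rewrite /= linearZ dvdz_mull.
Qed.

Lemma q_gorenstein_of_dvdz (R : realType) (d : Order.disp_t)
    (P : finPOrderType d) (u : braid_dual_lattice P) (r : nat) :
    (0 < r)%N ->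
    (forall v, is_ray_generator R v -> (u v : int) = r%:Z) ->
    (forall i : P, (r %| (u (indic int (pred1 i)) : int))%Z) ->
  gorenstein R P.
Proof.
move=> r_gt0 ur /dvdz_linear r_dvd.
have r0 : r%:Z != 0 by rewrite eqz_nat -lt0n.
have [u' u'E] := linear_divz r0 r_dvd; exists u' => v /ur uv.
by apply: (mulIf r0); rewrite -u'E uv mul1r.
Qed.

Theorem theorem5p2 (R : realType) (d : Order.disp_t) (P : finPOrderType d)
    (cardP : (2 <= #|P|)%N) (connP : hasse_connected P)
    (extP : has_minimum P \/ has_maximum P) :
  gorenstein R P <-> q_gorenstein R P.
Proof.
split=> [gP|[r r_gt0 [u ur]]]; first by exists 1%N.
apply: (q_gorenstein_of_dvdz r_gt0 ur).
have uE (F : {pred P}) :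
    (u (indic int F) : int) = \sum_(i in F) (u (indic int (pred1 i)) : int).
  by rewrite indicE raddf_sum.
case: extP => [[b b_min]|[t t_max]].
  apply: dvdz_principal_filters => x.
  rewrite -(uE [pred j | (x <= j)%O]); have [->|ne_xb] := eqVneq x b.
    (* The filter of [b] is all of [P], and its indicator is diagonal. *)
    suff -> : indic int [pred j | (b <= j)%O] = 0 by rewrite raddf0 dvdz0.
    rewrite -(indicT int P); congr diag_pi.
    by apply/ffunP => i; rewrite !ffunE !inE b_min.
  have lt_bx : (b < x)%O by rewrite lt_neqAle eq_sym ne_xb b_min.
  rewrite ur //; apply: (indic_ray_generator R (a := x) (b := b)) => //.
  - by move=> i j le_ij; rewrite !inE => /le_trans; apply.
  - by rewrite inE.
  - by rewrite inE lt_geF.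
  - by move=> i; rewrite inE => /ge_comparable.
  - by move=> i _; apply: ge_comparable.
(* Principal filters of the dual order are principal ideals of [P]. *)
apply: (@dvdz_principal_filters _ P^d) => x.
rewrite -(uE [pred j | (j <= x :> P)%O]); have [->|ne_xt] := eqVneq x t.
  suff -> : indic int [pred j | (j <= t :> P)%O] = 0 by rewrite raddf0 dvdz0.
  rewrite -(indicT int P); congr diag_pi.
  by apply/ffunP => i; rewrite !ffunE !inE t_max.
have lt_xt : ((x : P) < t)%O by rewrite lt_neqAle ne_xt t_max.
(* The ideal is not an up-set but its complement is; the indicators are opposite classes, and the
   sign does not affect divisibility. *)
rewrite -[indic _ _]opprK -indicC raddfN rpredN /= ur //.
apply: (indic_ray_generator R (a := t) (b := x : P)) => //.
- by move=> i j le_ij; rewrite !inE; apply/contra/le_trans.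
- by rewrite !inE lt_geF.
- by rewrite !inE lexx.
- by move=> i _; apply: le_comparable.
- by move=> i; rewrite !inE negbK => /le_comparable.
Qed.
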